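(* Let $m,d\ge 1$ be integers and let $\mathcal{I}_{m,d}$ be the ideal of the polynomial ring $\mathbb{F}_2\left[b^{(s)}_{i,j}\mid i,s\in[m],\,j\in[d]\right]$ generated by $\mathcal{S}_0\cup\mathcal{S}_1\cup\mathcal{S}_2\cup\mathcal{S}_3$ with $$\mathcal{S}_0=\left\{\left(b^{(s)}_{i,j}\right)^2-b^{(s)}_{i,j}\;\middle|\; i,s\in[m],\,j\in[d]\right\},$$ $$\mathcal{S}_1=\left\{\prod_{i=1}^{m}\prod_{j=1}^{d}\left(1+\sum_{s\in S}b^{(s)}_{i,j}\right)\;\middle|\; S\subseteq[m],\,S\neq\emptyset\right\},$$ $$\mathcal{S}_2=\left\{b^{(s)}_{i,j}-b^{(i)}_{s,j}\;\middle|\; i,s\in[m],\,j\in[d]\right\},$$ $$\mathcal{S}_3=\left\{b^{(i)}_{i,j}\;\middle|\; i\in[m],\,j\in[d]\right\}.$$ Then $$|\mathcal{V}(\mathcal{I}_{m,d})|\le 2^{d\frac{m(m-1)}{2}}-1-\sum_{r=1}^{m-2}\binom{m}{r}\left(2^d-1\right)^{\binom{m-r}{2}}.$$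
   Context: $[s]=\{1,\dots,s\}$. $\mathcal{V}(\mathcal{I}_{m,d})$ is the variety of $\mathcal{I}_{m,d}$, i.e. the set of its common zeros; since the ideal contains the field equations $\mathcal{S}_0$, all zeros have coordinates in $\mathbb{F}_2$. A sum over an empty range is $0$. *)

(* Defs.v *)
From HB Require Import structures.
From mathcomp Require Import all_boot all_order all_algebra.
From mathcomp Require Import mpoly.
From mathcomp Require Import classical_sets functions cardinality.

Set Implicit Arguments.
Unset Strict Implicit.
Unset Printing Implicit Defensive.

Import GRing.Theory.
Local Open Scope ring_scope.
Local Open Scope classical_set_scope.

Section IdealVariety.

Definition ideal_gen (R : comNzRingType) (G : set R) : set R :=
  [set p | exists (l : nat) (c g : 'I_l -> R),
     (forall k, G (g k)) /\ p = \sum_(k < l) c k * g k].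

(* Common zeros with coordinates in an extension K of F, embedded by iota. *)
Definition variety (F K : fieldType) (iota : {rmorphism F -> K}) (n : nat)
    (I : set {mpoly F[n]}) : set {ffun 'I_n -> K} :=
  [set v | forall p, I p -> (map_mpoly iota p).@[v] = 0].

End IdealVariety.

Section SystemS.
Variables m d : nat.

(* A triple (s, i, j) stands for the variable with upper index s and lower
   indices i, j; mpoly wants its variables numbered, hence enum_rank below. *)
Definition nvars : nat := #|{: 'I_m * 'I_m * 'I_d}|.

Local Notation polyring := {mpoly 'F_2[nvars]}.

Definition b (s i : 'I_m) (j : 'I_d) : polyring := 'X_(enum_rank (s, i, j)).

Definition S0 : set polyring :=
  [set p | exists s i j, p = b s i j ^+ 2 - b s i j].

Definition S1 : set polyring :=
  [set p | exists2 S : {set 'I_m}, S != finset.set0 &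
     p = \prod_(i < m) \prod_(j < d) (1 + \sum_(s in S) b s i j)].

Definition S2 : set polyring :=
  [set p | exists s i j, p = b s i j - b i s j].

Definition S3 : set polyring :=
  [set p | exists i j, p = b i i j].

Definition ideal_Imd : set polyring := ideal_gen (S0 `|` S1 `|` S2 `|` S3).

End SystemS.

Arguments ideal_Imd m d : clear implicits.

(* Main.v *)
Require Import Defs.
From mathcomp Require Import all_boot all_order all_algebra.
From mathcomp Require Import mpoly.
From mathcomp Require Import classical_sets functions cardinality.

Set Implicit Arguments.
Unset Strict Implicit.
Unset Printing Implicit Defensive.

Import GRing.Theory Num.Theory.

(** Let [V] be the variety.  The field equations force every coordinate of a
    point of [V] to be 0 or 1, and [S2] and [S3] say that the array
    [b^(s)_(i, j)] is symmetric in [s] and [i] with zero diagonal.  Such a point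
    is therefore a graph on the vertex set [[m]] whose edges [{s, i}] carry
    labels in [{0, 1}^d], the zero label meaning that the edge is absent
    ([graph_of], [graph_ofE], [graph_ofK]); there are [2 ^ (d * 'C(m, 2))] such
    labelled graphs.

    Of the family [S1] only the singletons [S = {s}] are exploited: they say
    that some [b^(s)_(i, j)] is nonzero, i.e. that the vertex [s] is not
    isolated ([zero_no_isolated]).  So [V] has at most as many points as there
    are labelled graphs without isolated vertex ([graph_of_spanning]).

    It remains to exhibit enough graphs with an isolated vertex.  For each
    proper subset [U] of the vertices with [#|U| <> 1], take the graphs in
    which exactly the pairs inside [U] are edges.  There are
    [(2 ^ d - 1) ^ 'C(#|U|, 2)] of them, and since [U] is then the set of
    non-isolated vertices, different [U] yield different graphs
    ([touched_complete]).  The empty [U] accounts for the summand 1, and the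
    sets [U] whose complement has [r] elements, with [1 <= r <= m - 2], for the
    summand of index [r] ([spanning_graphs_bound], [sum_proper_subsets]). *)

(** * Labelled graphs and their isolated vertices *)

Section LabelledGraphs.
Variables (T L : finType) (l0 : L).

Definition pairs (U : {set T}) : {set {set T}} :=
  [set e : {set T} | e \subset U & #|e| == 2].

(** A labelled graph is a function on all vertex sets that takes the value [l0]
    (no edge) away from the two-element sets.  Keeping the domain fixed lets
    graphs living on different [U] be compared without casts. *)
Definition graphs := pffun_on l0 (pairs [set: T]) (@predT L).

Definition complete_graphs (U : {set T}) :=
  pffun_on l0 (pairs U) (predC1 l0).

Definition touched (w : {ffun {set T} -> L}) : {set T} :=
  \bigcup_(e | w e != l0) e.

Lemma card_graphs : #|graphs| = (#|L| ^ 'C(#|T|, 2))%N.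
Proof. by rewrite card_pffun_on cards_draws cardsT. Qed.

Lemma card_complete_graphs (U : {set T}) :
  #|complete_graphs U| = (#|L|.-1 ^ 'C(#|U|, 2))%N.
Proof. by rewrite card_pffun_on cards_draws cardC1. Qed.

Lemma complete_graphs_sub (U : {set T}) :
  {subset complete_graphs U <= graphs}.
Proof.
move=> w /pffun_onP[/fintype.subsetP wU _]; apply/pffun_onP; split=> //.
apply/fintype.subsetP => e /wU; rewrite !inE => /andP[_ ->].
by rewrite finset.subsetT.
Qed.

(** A vertex of [U] has a neighbour as soon as [U] has another element, so [U]
    can be read off the graph.  A singleton [U] is excluded because its only
    complete graph is the empty one, which already belongs to the empty set. *)
Lemma touched_complete (U : {set T}) w :
  #|U| != 1%N -> w \in complete_graphs U -> touched w = U.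
Proof.
move=> U1 /pffun_onP[/fintype.subsetP wU wN0]; apply/finset.setP => x.
apply/bigcupP/idP => [[e we xe]|xU].
  by have := wU e we; rewrite inE => /andP[/fintype.subsetP/(_ x xe)].
have /card_gt0P[y] : (0 < #|U :\ x|)%N.
  have := cardsD1 x U; rewrite xU => Ux.
  by move: U1; rewrite Ux; case: #|_|.
rewrite in_setD1 => /andP[yx yU].
exists [set x; y]; last exact: set21.
apply: wN0; apply: fintype.image_f; rewrite inE cards2 (eq_sym x) yx andbT.
by apply/fintype.subsetP => z /set2P[] ->.
Qed.

(** Classify all graphs by their set [U] of non-isolated vertices: the full set
    gives the graphs to be bounded, and the class of any other [U]
    that is not a singleton contains the complete graphs on [U], whence the subtracted terms. *)
Lemma spanning_graphs_bound :
  (#|[set w in graphs | touched w == [set: T]]| +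
   \sum_(U : {set T} | (U != [set: T]) && (#|U| != 1))
      #|L|.-1 ^ 'C(#|U|, 2) <= #|L| ^ 'C(#|T|, 2))%N.
Proof.
rewrite -card_graphs -[X in (_ <= X)%N]sum1_card.
rewrite (partition_big touched predT) //= [X in (_ <= X)%N](bigD1 [set: T]) //=.
apply: leq_add; first by rewrite -sum1_card; apply/eq_leq/eq_bigl => w; rewrite inE.
rewrite [X in (_ <= X)%N](bigID (fun U : {set T} => #|U| != 1%N)) /=.
apply: (leq_trans _ (leq_addr _ _)); apply: leq_sum => U /andP[_ U1].
rewrite -card_complete_graphs -sum1_card.
rewrite [X in (_ <= X)%N](bigID (mem (complete_graphs U))) /=.
apply: (leq_trans _ (leq_addr _ _)); apply/eq_leq/eq_bigl => w.
case: (boolP (w \in complete_graphs U)) => wU; last by rewrite andbF.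
by rewrite (complete_graphs_sub wU) (touched_complete U1 wU) eqxx.
Qed.

End LabelledGraphs.

(** * Summation over proper subsets *)

Lemma sum_subsets_by_card (T : finType) (P : pred nat) (f : nat -> nat) :
  (\sum_(U : {set T} | P #|U|) f #|U| =
   \sum_(0 <= k < #|T|.+1 | P k) 'C(#|T|, k) * f k)%N.
Proof.
rewrite big_mkord.
have cU (U : {set T}) : (#|U| < #|T|.+1)%N by rewrite ltnS max_card.
rewrite (partition_big (fun U : {set T} => Ordinal (cU U)) (fun k : 'I__ => P k)) //=.
apply: eq_bigr => k Pk; rewrite -card_draws -sum_nat_const.
apply: eq_big => [U|U /andP[_ /eqP/(congr1 val)/= -> //]].
by rewrite inE -val_eqE /=; case: (#|U| =P k) => [->|]; rewrite ?Pk ?andbF.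
Qed.

Lemma sum_proper_subsets (T : finType) (q : nat) : (0 < #|T|)%N ->
  (\sum_(U : {set T} | (U != [set: T]) && (#|U| != 1)) q ^ 'C(#|U|, 2) =
   1 + \sum_(1 <= r < #|T|.-1) 'C(#|T|, r) * q ^ 'C(#|T| - r, 2))%N.
Proof.
move=> T0.
pose P k := (k != #|T|) && (k != 1%N).
transitivity (\sum_(U : {set T} | P #|U|) q ^ 'C(#|U|, 2))%N.
  apply: eq_bigl => U; rewrite /P; congr (~~ _ && _).
  by rewrite eqEcard finset.subsetT cardsT eqn_leq max_card.
rewrite (sum_subsets_by_card T P (fun k => q ^ 'C(k, 2))%N).
case: #|T| T0 @P => // n _ P.
rewrite big_mkcond big_nat_recl // /P /= bin0 mul1n expn0; congr (1 + _)%N.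
rewrite big_nat_recr //= eqxx addn0.
case: n @P => [|n] P; first by rewrite !big_geq.
rewrite big_nat_recl //= add0n big_add1 big_nat_rev /= add0n.
apply: eq_big_nat => r /= rn.
(* The reversed sum is indexed by [r.+1 = #|~: U|] instead of [#|U|]. *)
have -> : ((n - r.+1).+2 = n.+2 - r.+1)%N by rewrite -!subSn // ltnW.
rewrite bin_sub ?ltnS 1?leqW 1?ltnW //.
by have -> : (n.+2 - r.+1 != n.+2)%N by rewrite subSS ltn_eqF // ltnS leq_subr.
Qed.

(** * Points of the variety as labelled graphs *)

Local Open Scope ring_scope.

Lemma ideal_gen_mem (R : comNzRingType) (G : set R) (p : R) :
  G p -> ideal_gen G p.
Proof.
move=> Gp; exists 1%N, (fun=> 1), (fun=> p); split=> //.
by rewrite big_ord1 mul1r.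
Qed.

Section Zeros.
Variables (m d : nat) (K : fieldType) (iota : {rmorphism 'F_2 -> K}).

Definition coord (v : {ffun 'I_(nvars m d) -> K}) (s i : 'I_m) (j : 'I_d) : K :=
  v (enum_rank (s, i, j)).

Lemma eval_b (v : {ffun 'I_(nvars m d) -> K}) s i j :
  (map_mpoly iota (b s i j)).@[v] = coord v s i j.
Proof. by rewrite map_mpolyX mevalXU. Qed.

Variable v : {ffun 'I_(nvars m d) -> K}.
Hypothesis v_zero : variety iota (ideal_Imd m d) v.

Lemma zero_bool s i j : coord v s i j = (coord v s i j != 0)%:R.
Proof.
have /v_zero : ideal_Imd m d (b s i j ^+ 2 - b s i j).
  by apply: ideal_gen_mem; left; left; left; exists s, i, j.
rewrite !rmorphB !rmorphXn /= eval_b => /eqP.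
rewrite expr2 -{3}[coord _ _ _ _]mulr1 -mulrBr mulf_eq0 subr_eq0.
by case/orP=> /eqP ->; rewrite ?eqxx ?oner_eq0.
Qed.

Lemma zero_sym s i j : coord v s i j = coord v i s j.
Proof.
have /v_zero : ideal_Imd m d (b s i j - b i s j).
  by apply: ideal_gen_mem; left; right; exists s, i, j.
by rewrite !rmorphB /= !eval_b => /eqP; rewrite subr_eq0 => /eqP.
Qed.

Lemma zero_diag i j : coord v i i j = 0.
Proof.
have /v_zero : ideal_Imd m d (b i i j).
  by apply: ideal_gen_mem; right; exists i, j.
by rewrite eval_b.
Qed.

(** The generator of [S1] attached to [{s}] evaluates to 1 when all the
    coordinates of upper index [s] vanish. *)
Lemma zero_no_isolated s : exists i j, coord v s i j != 0.
Proof.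
have /v_zero : ideal_Imd m d
    (\prod_(i < m) \prod_(j < d) (1 + \sum_(t in [set s]) b t i j)).
  apply: ideal_gen_mem; left; left; right; exists [set s] => //.
  by apply/set0Pn; exists s; rewrite finset.set11.
rewrite !rmorph_prod /= => /eqP/prodf_eq0[i _].
rewrite !rmorph_prod /= => /prodf_eq0[j _].
rewrite finset.big_set1 !rmorphD !rmorph1 /= eval_b => h; exists i, j.
by apply: contraTneq h => ->; rewrite addr0 oner_eq0.
Qed.

(** Asking for some ordered pair of vertices of [e] avoids choosing an
    orientation of the edge; by symmetry and the zero diagonal this choice
    would not matter on a zero of the ideal. *)
Definition graph_of : {ffun {set 'I_m} -> {ffun 'I_d -> bool}} :=
  [ffun e : {set 'I_m} => [ffun j =>
     (#|e| == 2)%N && [exists s in e, exists i in e, coord v s i j != 0]]].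

Lemma graph_ofE s i j : graph_of [set s; i] j = (coord v s i j != 0).
Proof.
rewrite !ffunE cards2; case: (eqVneq s i) => [->|si] /=.
  by rewrite zero_diag eqxx.
apply/exists_inP/idP => [[s' s'e /exists_inP[i' i'e]]|vN0]; last first.
  exists s; first exact: set21.
  by apply/exists_inP; exists i => //; apply: set22.
case/set2P: s'e => ->; case/set2P: i'e => ->; rewrite ?zero_diag ?eqxx //.
by rewrite zero_sym.
Qed.

Lemma graph_of_spanning :
  graph_of \in [set w in graphs 'I_m [ffun=> false] | touched [ffun=> false] w == [set: 'I_m]].
Proof.
rewrite inE; apply/andP; split.
  apply/pffun_onP; split=> //; apply/fintype.subsetP => e; rewrite inE => eN0.
  rewrite inE finset.subsetT /=; apply: contraNT eN0 => /negPf e2.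
  by apply/eqP/ffunP => j; rewrite !ffunE e2.
apply/eqP/finset.setP => s; rewrite inE; apply/bigcupP.
have [i [j vN0]] := zero_no_isolated s.
exists [set s; i]; last exact: set21.
by apply: contraTneq vN0 => /ffunP/(_ j); rewrite graph_ofE ffunE => ->.
Qed.

End Zeros.

Definition point_of (m d : nat) (K : fieldType)
    (w : {ffun {set 'I_m} -> {ffun 'I_d -> bool}}) : {ffun 'I_(nvars m d) -> K} :=
  [ffun k => let: (s, i, j) := enum_val k in (w [set s; i] j)%:R].

Lemma graph_ofK (m d : nat) (K : fieldType) (iota : {rmorphism 'F_2 -> K}) v :
  variety iota (ideal_Imd m d) v -> point_of K (graph_of v) = v.
Proof.
move=> v_zero; apply/ffunP => k; rewrite ffunE.
rewrite -[in RHS](enum_valK k); case: (enum_val k) => [[s i] j].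
by rewrite (graph_ofE v_zero) -(zero_bool v_zero).
Qed.

(** * Counting *)

(** A set covered by the image of a finite set [G] is finite with at most
    [#|G|] elements, stated with the cardinal as an explicit natural number. *)
Lemma card_finite_image (A : finType) (B : Type) (G : {set A}) (f : A -> B)
    (V : set B) :
  (forall y, V y -> exists2 x, x \in G & f x = y) ->
  exists N, (V #= `I_N)%card /\ (N <= #|G|)%N.
Proof.
move=> VG.
have VI : (V #<= `I_#|G|)%card.
  have [x0 _|G0] := pickP (mem G).
    apply: card_le_trans (card_image_le (fun k => f (nth x0 (enum G) k)) _).
    apply: subset_card_le => y /VG[x xG <-]; exists (index x (enum G)).
      by rewrite /= cardE index_mem mem_enum.
    by rewrite nth_index // mem_enum.
  apply: (card_le_trans _ (card_ge0 B _)).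
  by apply: subset_card_le => y /VG[x xG _]; rewrite -[_ \in _]/(mem G x) G0 in xG.
have /finite_setP[N VN] : finite_set V by apply/finite_set_leP; exists #|G|.
by exists N; split=> //; rewrite -card_le_II -(card_le_eql VN).
Qed.

Theorem theorem4p7 (m d : nat) (hm : (1 <= m)%N) (hd : (1 <= d)%N)
    (K : fieldType) (iota : {rmorphism 'F_2 -> K}) :
  exists N : nat,
    (variety iota (ideal_Imd m d) #= `I_N)%card /\
    (N%:Z <= 2 ^+ (d * (m * (m - 1)) %/ 2)%N - 1
             - \sum_(1 <= r < m.-1) 'C(m, r)%:Z * (2 ^+ d - 1) ^+ 'C(m - r, 2))%R.
Proof.
pose l0 : {ffun 'I_d -> bool} := [ffun=> false].
pose G := [set w in graphs 'I_m l0 | touched l0 w == [set: 'I_m]].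
have [N [VN leNG]] :
    exists N, (variety iota (ideal_Imd m d) #= `I_N)%card /\ (N <= #|G|)%N.
  apply: (card_finite_image (f := point_of K)) => v v_zero.
  by exists (graph_of v); [exact: graph_of_spanning v_zero | exact: graph_ofK v_zero].
exists N; split=> //.
have edges : ((d * (m * (m - 1))) %/ 2 = d * 'C(m, 2))%N.
  by rewrite subn1 -(ffactn1 m.-1) -ffactnS -bin_ffact mulnA mulnK.
have := spanning_graphs_bound 'I_m l0.
rewrite sum_proper_subsets ?card_ord // card_ffun card_bool card_ord -expnM edges.
move=> /(leq_trans (leq_add leNG (leqnn _))).
have q1 : (2 ^ d).-1%:R = 2 ^+ d - 1 :> int.
  by rewrite -subn1 natrB ?expn_gt0 // natrX.
rewrite -(ler_nat int) [(1 + _)%N]addnC !natrD natr_sum natrX natz addrA -!lerBrDr.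
by under eq_bigr do rewrite natrM natrX q1 natz.
Qed.
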